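(* For every natural number $r\ge 1$ there exist a constant $c_1(r)$, depending only on $r$, and a sequence of natural numbers $\{n_k\}_{k=1}^{\infty}$ such that $d(n_k)\to\infty$ as $k\to\infty$ and, for all $k\ge 1$, $$H(r,n_k)\geq \frac{1}{2^r r!}\,d(n_k)^r-c_1(r)\,d(n_k)^{r-1}.$$
   Context: For $f\in\mathbb{Z}[x]$, $(f)_r$ denotes the coefficient of $x^r$ in $f$ (equal to $0$ if $r>\deg f$). For natural numbers $r,n$, define $H(r,n)=\max\{|(g)_r| : g\in\mathbb{Z}[x],\ g\mid (x^n-1)\}$. $d(n)$ denotes the number of positive divisors of $n$. *)

(* Defs.v *)
From mathcomp Require Import all_boot all_order all_algebra all_field.
From mathcomp Require Import all_classical all_reals all_analysis.
Set Implicit Arguments.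
Unset Strict Implicit.
Unset Printing Implicit Defensive.

Import Order.TTheory GRing.Theory Num.Theory.
Local Open Scope classical_set_scope.
Local Open Scope ring_scope.

(* Divisibility in Z[x]. The library's [%|] on {poly int} is a
   pseudo-divisibility, i.e. it amounts to divisibility in Q[x]. *)
Definition zpoly_dvd (g f : {poly int}) : Prop :=
  exists q : {poly int}, f = q * g.

Definition coef_heights (r n : nat) : set nat :=
  [set absz g`_r | g in [set g : {poly int} | zpoly_dvd g ('X^n - 1)]].

Definition is_max (A : set nat) (m : nat) : Prop :=
  A m /\ forall k, A k -> (k <= m)%N.

(* For 0 < n this is the maximum of [coef_heights r n] (lemma [H_is_max]);
   the maximum does not exist for n = 0, where the value is irrelevant. *)
Definition H (r n : nat) : nat := xget 0%N (is_max (coef_heights r n)).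

Definition num_divisors (n : nat) : nat := size (divisors n).

Lemma coef_prod_XsubC_le (s : seq algC) (i : nat) :
  (forall z, z \in s -> `|z| <= 1) ->
  `|(\prod_(z <- s) ('X - z%:P))`_i| <= 2 ^+ size s.
Proof.
elim: s i => [|z s IHs] i hs.
  by rewrite big_nil coef1 expr0 normr_nat lern1 leq_b1.
have hs' w : w \in s -> `|w| <= 1 by move=> ws; apply: hs; rewrite inE ws orbT.
rewrite big_cons mulrBl coefB coefXM coefCM /= exprS mulrDl mul1r.
apply: le_trans (ler_normB _ _) _; apply: lerD.
  by case: eqP => _; [rewrite normr0 exprn_ge0|apply: IHs].
rewrite normrM -[leRHS]mul1r.
by apply: ler_pM; rewrite ?normr_ge0 ?IHs ?hs ?mem_head.
Qed.

Lemma coef_heights_bounded (r n k : nat) :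
  (0 < n)%N -> coef_heights r n k -> (k <= 2 ^ n)%N.
Proof.
move=> n_gt0 [g [q Eqg] <-].
have qg_neq0 : q * g != 0 by rewrite -Eqg -size_poly_eq0 size_XnsubC.
have /norP[q_neq0 g_neq0] : ~~ ((q == 0) || (g == 0)) by rewrite -mulf_eq0.
have size_g : ((size g).-1 <= n)%N.
  have: (size g <= size (q * g)%R)%N.
    by rewrite size_mul // -(prednK (_ : 0 < size q)%N) ?size_poly_gt0 //= leq_addl.
  by rewrite -Eqg size_XnsubC // => hs; rewrite -ltnS prednK ?size_poly_gt0.
have lead_g : absz (lead_coef g) = 1%N.
  have: lead_coef q * lead_coef g = 1 by rewrite -lead_coefM -Eqg lead_coefXnsubC.
  move=> /(congr1 absz); rewrite abszM /= => /eqP.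
  by rewrite muln_eq1 => /andP[_ /eqP].
pose f : {rmorphism int -> algC} := intr.
have [s Es] := closed_field_poly_normal (map_poly f g).
have lead_f : `|lead_coef (map_poly f g)| = 1.
  rewrite lead_coef_map_inj //; last exact: intr_inj.
  by rewrite /f -intr_norm -abszE lead_g.
have lf_neq0 : lead_coef (map_poly f g) != 0.
  by rewrite -normr_eq0 lead_f oner_eq0.
have size_s : size s = (size g).-1.
  have := congr1 (fun p : {poly algC} => size p) Es.
  rewrite size_map_inj_poly ?rmorph0 //; last exact: intr_inj.
  by rewrite size_scale // size_prod_XsubC => ->.
have roots_s z : z \in s -> `|z| <= 1.
  move=> zs.
  have rg : root (map_poly f g) z by rewrite Es rootZ // root_prod_XsubC.
  have : root (map_poly f ('X^n - 1)) z by rewrite Eqg rmorphM /= rootM rg orbT.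
  rewrite rmorphB /= map_polyXn rmorph1 /root hornerD hornerN hornerXn hornerC.
  rewrite subr_eq0 => /eqP /(congr1 Num.norm); rewrite normrX normr1 => zn1.
  by rewrite -(@expr_le1 _ n) // zn1.
have: `|(map_poly f g)`_r| <= 2 ^+ n.
  rewrite Es coefZ normrM lead_f mul1r.
  apply: le_trans (coef_prod_XsubC_le _ roots_s) _.
  by rewrite size_s ler_eXn2l ?ltr1n.
rewrite coef_map /= /f -intr_norm -abszE.
by rewrite -natrX ler_nat.
Qed.

Lemma H_is_max (r n : nat) : (0 < n)%N -> is_max (coef_heights r n) (H r n).
Proof.
move=> n_gt0; apply: (@xgetPex _ 0%N (is_max (coef_heights r n))).
have exA : exists k, `[< coef_heights r n k >].
  exists (absz (1 : {poly int})`_r); apply/asboolP; exists 1 => //.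
  by exists ('X^n - 1); rewrite mulr1.
have ubA k : `[< coef_heights r n k >] -> (k <= 2 ^ n)%N.
  by move=> /asboolP; apply: coef_heights_bounded.
case: (ex_maxnP exA ubA) => m /asboolP Am mmax; exists m; split=> // k Ak.
by apply: mmax; apply/asboolP.
Qed.

(* Main.v *)
(** Let n be a product of k + 1 distinct primes larger than r, and work modulo
    X^(r+1). For a prime p > r not dividing d, the identity
    Phi_(d p)(X) Phi_d(X) = Phi_d(X^p) makes Phi_(d p) Phi_d constant modulo
    X^(r+1), so that Phi_d is congruent to (1 - X)^-1 whenever d has an odd
    number of prime factors. Half of the d(n) = 2^(k+1) divisors are of this
    kind; the product of their Phi_d divides X^n - 1 and is congruent to
    (1 - X)^(-d(n)/2), whose coefficient of X^r is
    C(d(n)/2 + r - 1, r) >= (d(n)/2)^r / r!. In particular c_1(r) = 0 works. *)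

Require Import Defs.
From mathcomp Require Import all_boot all_order all_algebra.
From mathcomp Require Import cyclotomic.
From mathcomp Require Import all_classical all_reals all_analysis.
Set Implicit Arguments.
Unset Strict Implicit.
Unset Printing Implicit Defensive.
Import Order.TTheory GRing.Theory Num.Theory.
Local Open Scope classical_set_scope.
Local Open Scope ring_scope.

(** A divisor of [n * p] prime to [p] divides [n] by Gauss; any other is [p] times a divisor of
    [n]. *)
Lemma perm_divisorsMp (n p : nat) : (0 < n)%N -> prime p -> ~~ (p %| n)%N ->
  perm_eq (divisors (n * p)) (divisors n ++ [seq (d * p)%N | d <- divisors n]).
Proof.
move=> n_gt0 p_pr pNn; have p_gt0 := prime_gt0 p_pr.
apply: uniq_perm; first exact: divisors_uniq.
  rewrite cat_uniq divisors_uniq map_inj_uniq ?divisors_uniq ?andbT /=; last first.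
    by move=> a b /eqP; rewrite eqn_pmul2r // => /eqP.
  apply/hasPn => _ /mapP[d _ ->]; rewrite -dvdn_divisors //.
  by apply: contra pNn; apply: dvdn_trans; apply: dvdn_mull.
move=> d; rewrite mem_cat -!dvdn_divisors ?muln_gt0 ?n_gt0 //.
apply/idP/orP => [dnp|[dn|/mapP[e]]].
- have [/dvdnP[e Ed]|pNd] := boolP (p %| d)%N.
    right; rewrite Ed; apply: map_f.
    by move: dnp; rewrite Ed dvdn_pmul2r // -dvdn_divisors.
  by left; rewrite -(@Gauss_dvdl d n p) // coprime_sym prime_coprime.
- exact: dvdn_mulr.
- by rewrite -dvdn_divisors // => en ->; rewrite dvdn_pmul2r.
Qed.

(** Strong induction on [n]: multiplied over all divisors of [n], both sides give ['X^(n * p) - 1],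
    and the factors at proper divisors agree and cancel. *)
Lemma CyclotomicMp (n p : nat) : (0 < n)%N -> prime p -> ~~ (p %| n)%N ->
  'Phi_(n * p) * 'Phi_n = 'Phi_n \Po 'X^p.
Proof.
move=> + p_pr; have p_gt0 := prime_gt0 p_pr.
elim/ltn_ind: n => n IHn n_gt0 pNn.
have np_gt0 : (0 < n * p)%N by rewrite muln_gt0 n_gt0.
pose f d := 'Phi_(d * p) * 'Phi_d; pose g d := 'Phi_d \Po 'X^p.
have Efg : \prod_(d <- divisors n) f d = \prod_(d <- divisors n) g d.
  rewrite big_split /= mulrC.
  rewrite -(big_map (fun d => d * p)%N xpredT (fun d => 'Phi_d)) -big_cat.
  rewrite -(perm_big _ (perm_divisorsMp n_gt0 p_pr pNn)) prod_Cyclotomic //=.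
  rewrite -(rmorph_prod (comp_poly ('X^p : {poly int}))) prod_Cyclotomic //=.
  by rewrite comp_polyB comp_Xn_poly comp_polyC -exprM mulnC.
have g_neq0 d : g d != 0.
  rewrite comp_poly_eq0 ?monic_neq0 ?Cyclotomic_monic //.
  by rewrite size_polyXn.
have n_div : n \in divisors n by rewrite -dvdn_divisors.
move: Efg; rewrite !(perm_big _ (perm_to_rem n_div)) !big_cons.
set A := \prod_(_ <- _) _; set B := \prod_(_ <- _) _.
have -> : A = B.
  apply: eq_big_seq => d; rewrite mem_rem_uniq ?divisors_uniq // inE.
  case/andP=> dn; rewrite -dvdn_divisors // => ddn; apply: IHn.
  - by rewrite ltn_neqAle dn dvdn_leq.
  - exact: dvdn_gt0 ddn.
  - by apply: contra pNn => pd; apply: dvdn_trans ddn.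
by apply: mulIf; rewrite prodf_seq_neq0; apply/allP => d _; apply: g_neq0.
Qed.

Section TruncatedCongruence.

Variables (A : comNzRingType) (r : nat).
Implicit Types p q s : {poly A}.

Definition eq_upto p q := forall i, (i <= r)%N -> p`_i = q`_i.

Lemma eq_upto_sym p q : eq_upto p q -> eq_upto q p.
Proof. by move=> pq i ir; rewrite pq. Qed.

Lemma eq_upto_trans p q s : eq_upto p q -> eq_upto q s -> eq_upto p s.
Proof. by move=> pq qs i ir; rewrite pq ?qs. Qed.

Lemma eq_uptoMr s p q : eq_upto p q -> eq_upto (p * s) (q * s).
Proof.
move=> pq i ir; rewrite !coefM; apply: eq_bigr => j _.
by rewrite pq // (leq_trans _ ir) // -ltnS.
Qed.

Lemma eq_uptoMl s p q : eq_upto p q -> eq_upto (s * p) (s * q).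
Proof. by rewrite !(mulrC s); apply: eq_uptoMr. Qed.

(** Only exponents divisible by [m] occur in [p \Po 'X^m], and 0 is the only such exponent up to
    [r]. *)
Lemma eq_upto_comp_Xn p m : (r < m)%N -> eq_upto (p \Po 'X^m) (p`_0)%:P.
Proof.
move=> rm i ir; have m_gt0 : (0 < m)%N by apply: leq_ltn_trans rm.
rewrite coef_comp_poly_Xn // coefC; case: eqP => [->|/eqP i0].
  by rewrite dvdn0 div0n.
rewrite ifN //; apply/negP => /dvdn_leq; rewrite lt0n i0 => /(_ isT).
by rewrite leqNgt (leq_ltn_trans ir rm).
Qed.

Lemma eq_upto_Xn_sub_1 m : (r < m)%N -> eq_upto ('X^m - 1) (- 1).
Proof.
move=> rm i ir; rewrite coefB coefXn coefN [i == m]ltn_eqF ?sub0r //.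
exact: leq_ltn_trans rm.
Qed.

(** Here [p] is a truncated power series of [(1 - 'X)^-N]. Passing from [N] to [N.+1] turns
    coefficients into partial sums, which Pascal's rule evaluates. *)
Lemma eq_upto_inv_one_subX_exp p N i : eq_upto (p * (1 - 'X) ^+ N) 1 ->
  (i <= r)%N -> p`_i = 'C(N + i - 1, i)%:R.
Proof.
elim: N p i => [|N IHN] p i.
  rewrite expr0 mulr1 => p1 ir; rewrite p1 // coef1.
  (* Natural subtraction makes ['C(0 + i - 1, i)] equal to 1 at [i = 0] and 0 beyond. *)
  by case: i {ir} => [|i] //; rewrite bin_small // add0n subn1.
rewrite exprS mulrA => pN; elim: i => [|i IHi] ir.
  move: (IHN _ 0%N pN ir); rewrite mulrBr mulr1 coefB coefMX subr0 => ->.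
  by rewrite !bin0.
move: (IHN _ i.+1 pN ir); rewrite mulrBr mulr1 coefB coefMX /=.
move/eqP; rewrite subr_eq IHi ?(ltnW ir) // => /eqP->.
by rewrite addnS !subn1 addSn /= addnS binS natrD.
Qed.

End TruncatedCongruence.

(** The right side is the rising factorial of [N] with [r] factors, each at least [N]. *)
Lemma leq_exp_fact_bin (N r : nat) : (N ^ r <= r`! * 'C(N + r - 1, r))%N.
Proof.
elim: r => [|r IHr]; first by rewrite bin0.
rewrite expnS factS mulnAC -mul_bin_diag addnS subn1 /=.
rewrite [leqRHS]mulnC mulnCA; apply: leq_mul; first exact: leq_addr.
by rewrite -subn1.
Qed.

(** The complementary cyclotomic factors form an integral quotient. *)
Lemma prod_Cyclotomic_dvd (n : nat) (S T : seq nat) : (0 < n)%N ->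
  perm_eq (divisors n) (S ++ T) ->
  zpoly_dvd (\prod_(d <- S) 'Phi_d) ('X^n - 1).
Proof.
move=> n_gt0 nST; exists (\prod_(d <- T) 'Phi_d).
by rewrite -prod_Cyclotomic // (perm_big _ nST) big_cat mulrC.
Qed.

(* S and T collect the divisors of n with an odd, respectively even, number of
   prime factors; a new prime p turns them into S ++ pT and T ++ pS. *)
Lemma Cyclotomic_prod_exists (r k : nat) :
  exists (n : nat) (S T : seq nat),
    [/\ (r < n)%N, perm_eq (divisors n) (S ++ T),
        size S = (2 ^ k)%N /\ size T = (2 ^ k)%N &
        eq_upto r (\prod_(d <- S) 'Phi_d * (1 - 'X) ^+ (2 ^ k)) 1].
Proof.
elim: k => [|k [n [S [T [rn nST [sS sT] QN]]]]].
  have [p rp p_pr] := prime_above r.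
  have Phi1 : 'Phi_1 = 'X - 1.
    by have := @prod_Cyclotomic 1 isT; rewrite big_seq1.
  have pST : perm_eq (divisors p) ([:: p] ++ [:: 1%N]).
    apply: uniq_perm; first exact: divisors_uniq.
      by rewrite /= inE andbT neq_ltn prime_gt1 ?orbT.
    move=> d; rewrite -dvdn_divisors ?prime_gt0 // !inE orbC.
    apply/idP/idP => [|/pred2P[->|->]]; [|exact: dvd1n|exact: dvdnn].
    by have /primeP[_ /(_ d)] := p_pr.
  exists p, [:: p], [:: 1%N]; split=> //.
  rewrite big_seq1 expr1.
  (* As [r < p], the product ['Phi_p * ('X - 1) = 'X^p - 1] is congruent to -1. *)
  have := @prod_Cyclotomic p (prime_gt0 p_pr).
  rewrite (perm_big _ pST) big_cat !big_seq1 Phi1 /= => Ep.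
  rewrite -opprB mulrN Ep => i ir.
  by rewrite coefN (eq_upto_Xn_sub_1 _ rp) // coefN opprK.
(* Exceeding [r] makes ['X^p] vanish modulo ['X^r.+1]; exceeding [n] keeps [p] from dividing [n]. *)
have [p rnp p_pr] := prime_above (r + n).
have n_gt0 : (0 < n)%N by apply: leq_ltn_trans rn.
have rp : (r < p)%N by apply: leq_ltn_trans rnp; apply: leq_addr.
have pNn : ~~ (p %| n)%N.
  by rewrite gtnNdvd // (leq_ltn_trans _ rnp) ?leq_addl.
exists (n * p)%N, (S ++ [seq (d * p)%N | d <- T]),
  (T ++ [seq (d * p)%N | d <- S]).
split.
- by apply: leq_trans rp _; apply: leq_pmull.
- apply: perm_trans (perm_divisorsMp n_gt0 p_pr pNn) _.
  apply: perm_trans (perm_cat nST (perm_map _ nST)) _.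
  rewrite map_cat -!catA perm_cat2l perm_catC -!catA perm_catCA.
  by rewrite perm_cat2l perm_catC.
- by rewrite !size_cat !size_map sS sT addnn -mul2n -expnS.
set Q := \prod_(d <- S) _ in QN *; set U := (1 - 'X) ^+ _ in QN.
pose P := \prod_(d <- T) 'Phi_d; pose P' := \prod_(d <- T) 'Phi_(d * p).
rewrite big_cat big_map /= -/Q -/P' expnSr exprM expr2 -/U.
have PQ : P * Q = 'X^n - 1.
  by rewrite -prod_Cyclotomic // (perm_big _ nST) big_cat mulrC.
(* Since [Q * U] is congruent to 1, [P] is congruent to [P * Q * U = ('X^n - 1) * U], hence to [- U]
   because [r < n]. *)
have PU : eq_upto r P (- U).
  apply: (@eq_upto_trans _ _ _ (P * (Q * U))).
    by rewrite -{1}[P]mulr1; apply/eq_uptoMl/eq_upto_sym.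
  by rewrite mulrA PQ -[- U]mulN1r; apply/eq_uptoMr/eq_upto_Xn_sub_1.
have PP' : P' * P = P \Po 'X^p.
  rewrite (rmorph_prod (comp_poly ('X^p : {poly int}))) -big_split /=.
  apply: eq_big_seq => d dT.
  have dn : (d %| n)%N by rewrite dvdn_divisors // (perm_mem nST) mem_cat dT orbT.
  apply: CyclotomicMp => //; first exact: dvdn_gt0 dn.
  by apply: contra pNn => pd; apply: dvdn_trans dn.
have P0 : P`_0 = - 1.
  rewrite PU // coefN -horner_coef0 /U horner_exp hornerD hornerN hornerX hornerC.
  by rewrite subr0 expr1n.
(* Modulo ['X^r.+1], [P \Po 'X^p] reduces to the constant term -1 of [P], so [P' * P] is -1;
   substituting [- U] for [P] gives the claim. *)
have P'U : eq_upto r (P' * U) 1.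
  have P'P : eq_upto r (P' * P) (- 1).
    by rewrite PP' -polyCN -P0; apply: eq_upto_comp_Xn.
  have := eq_upto_trans (eq_upto_sym (eq_uptoMl P' PU)) P'P.
  by rewrite mulrN => h i ir; apply: oppr_inj; rewrite -!coefN h.
rewrite mulrACA -[1]mulr1.
by apply: eq_upto_trans (eq_uptoMr _ QN) (eq_uptoMl _ P'U).
Qed.

Lemma H_lower_bound (r k : nat) : exists n : nat,
  [/\ (0 < n)%N, num_divisors n = (2 ^ k.+1)%N &
      (num_divisors n ^ r <= 2 ^ r * r`! * H r n)%N].
Proof.
have [n [S [T [rn nST [sS sT] QN]]]] := Cyclotomic_prod_exists r k.
have n_gt0 : (0 < n)%N by apply: leq_ltn_trans rn.
have dn : num_divisors n = (2 ^ k.+1)%N.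
  by rewrite /num_divisors (perm_size nST) size_cat sS sT addnn -mul2n -expnS.
exists n; split=> //.
have [_ Hmax] := H_is_max r n_gt0.
(* [S] holds half of the divisors, whence the factor [2 ^ r]; what remains is to bound
   [(2 ^ k) ^ r]. *)
rewrite dn expnS expnMn -mulnA leq_pmul2l ?expn_gt0 //.
apply: leq_trans (leq_exp_fact_bin _ _) _; rewrite leq_pmul2l ?fact_gt0 //.
apply: Hmax; exists (\prod_(d <- S) 'Phi_d).
  exact: prod_Cyclotomic_dvd nST.
by rewrite (eq_upto_inv_one_subX_exp QN) // natz.
Qed.

Theorem theorem4p3 (R : realType) (r : nat) (r_ge1 : (1 <= r)%N) :
  exists (c1 : R) (n : nat -> nat),
    [/\ forall k : nat, (1 <= k)%N -> (0 < n k)%N,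
        num_divisors (n k) @[k --> \oo] --> \oo &
        forall k : nat, (1 <= k)%N ->
          (H r (n k))%:R >=
            1 / (2 ^+ r * (r`!)%:R) * (num_divisors (n k))%:R ^+ r
            - c1 * (num_divisors (n k))%:R ^+ (r - 1)].
Proof.
have [n nP] := choice (H_lower_bound r).
exists 0, n; split=> [k _||k _]; first by have [] := nP k.
  apply/cvgnyPge => m; exists m => // k /= mk.
  have [_ -> _] := nP k.
  by apply: (leq_trans mk); apply/ltnW/(ltn_trans (ltnSn k))/ltn_expl.
have [_ _ le_dH] := nP k.
rewrite mul0r subr0 mul1r mulrC ler_pdivrMr; last first.
  by rewrite mulr_gt0 ?exprn_gt0 ?ltr0n ?fact_gt0.
by rewrite mulrC -!natrX -!natrM ler_nat.
Qed.
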